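(* In the linear-convex setting, let $(V_t^k)_{k\in\mathbb N}$, $t\in\{0,\dots,T\}$, be the functions generated by the Tropical Dynamic Programming algorithm with the SDDP selection functions $\phi_t^{\mathrm{SDDP}}$, where for every $k\in\mathbb N$ the trial points $(x_0^k,x_1^k,\dots,x_T^k)$ form an optimal trajectory for the $k$-th approximations starting from $x_0$, and let $V_t^*$ be the limit of $(V_t^k)_k$. Define the singletons $K_t^k:=\{x_t^k\}$ for every $t\in\{0,\dots,T\}$. Then the sets $(K_t^* )_{t\in\{0,\dots,T\}}$ defined by $K_t^*:=\limsup_k K_t^k$ are $(V_t^* )$-optimal.
   Context: **Problem and assumptions (linear-convex setting).** $\mathbb X=\mathbb R^n$, $\mathbb U=\mathbb R^m$, $T$ a positive integer, $\overline{\mathbb R}=[-\infty,+\infty]$ with $+\infty+(-\infty)=+\infty$. $\mathrm{dom}(\phi)$ is the set where $\phi$ is finite; $\delta_X$ is $0$ on $X$, $+\infty$ elsewhere. For each $t\in\{0,\dots,T-1\}$: 1. $f_t(x,u)=A_tx+B_tu$ with matrices $A_t,B_t$ of compatible dimensions. 2. $c_t:\mathbb X\times\mathbb U\to\overline{\mathbb R}$ is proper, convex, lower semicontinuous (l.s.c.), and $L_{c_t}$-Lipschitz on $\mathrm{dom}(c_t)$. 3. $X_t$, the projection of $\mathrm{dom}(c_t)$ on $\mathbb X$, is a convex polytope with non-empty interior. 4. With $U_t(x):=\{u\in\mathbb U:(x,u)\in\mathrm{dom}(c_t),\ f_t(x,u)\in X_{t+1}\}$: $U_t(x)$ is compact and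 non-empty for every $x\in X_t$; the graph of $U_t$ has non-empty interior; $U_t$ is $L_{U_t}$-Lipschitz: $U_t(x')\subset U_t(x)+L_{U_t}\|x'-x\|\,\mathbb B$ for all $x,x'\in X_t$ ($\mathbb B$ the closed unit ball). At $t=T$: $\psi:\mathbb X\to\overline{\mathbb R}$ is proper convex l.s.c., its domain $X_T:=\mathrm{dom}(\psi)$ is convex compact with non-empty interior, and $\psi$ is $C_T$-Lipschitz on $X_T$. The initial state satisfies $x_0\in X_0$. **Bellman operators.** $\mathcal B_t^u(\phi)(x):=c_t(x,u)+\phi(f_t(x,u))$, $\mathcal B_t(\phi)(x):=\inf_{u\in\mathbb U}\mathcal B_t^u(\phi)(x)$. Value functions: $V_T=\psi$, $V_t=\mathcal B_t(V_{t+1})$; one has $\mathrm{dom}(V_t)=X_t$. **Constants.** $L_T:=C_T$ and for $t<T$, $L_t>0$ is a constant such that for every convex l.s.c. proper $\phi$ with domain $X_{t+1}$ that is $L_{t+1}$-Lipschitz on $X_{t+1}$, $\mathcal B_t(\phi)$ is convex l.s.c. proper with domain $X_t$ and $L_t$-Lipschitz on $X_t$ (such constants exist). **Basic functions.** $\mathbf F_t^{\mathrm{SDDP}}$ is the set of functions equal to $x\mapsto\langle a,x\rangle+b$ on $X_t$, with $\|a\|_2\le L_t$, $b\in\mathbb R$, and $+\infty$ outside $X_t$. For $F\subset\mathbf F_t^{\mathrm{SDDP}}$, $\mathcal V_F:=\sup_{\phi\in F}\phi$. **SDDP selection functions.** For $t<T$, $F\subset\mathbf F_{t+1}^{\mathrm{SDDP}}$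 and $x$, consider the problem: minimize $c_t(x',u)+\lambda$ over $x'\in X_t$, $u\in U_t(x')$, $\lambda\in\mathbb R$, subject to $x'=x$ and $\phi(f_t(x',u))\le\lambda$ for all $\phi\in F$. Let $b$ be its optimal value and $a$ a Lagrange multiplier associated with the constraint $x'-x=0$ at the optimum, i.e. such that $(x',u,\lambda;a)$ is a stationary point of the Lagrangian $c_t(x',u)+\lambda-\langle a,x'-x\rangle$ (the other constraints being kept), with $\|a\|\le L_t$. Then $\phi_t^{\mathrm{SDDP}}(F,x):=x'\mapsto\langle a,x'-x\rangle+b+\delta_{X_t}(x')$. For $t=T$, $\phi_T^{\mathrm{SDDP}}(F,x):=x'\mapsto\langle a,x'-x\rangle+V_T(x)+\delta_{X_T}(x')$ with $a\in\partial V_T(x)$, $\|a\|\le L_T$. **Algorithm.** $F_t^0=\emptyset$ for all $t$. At iteration $k=0,1,\dots$, given trial points $(x_0^k,\dots,x_T^k)$: $F_T^{k+1}=F_T^k\cup\{\phi_T^{\mathrm{SDDP}}(F_T^k,x_T^k)\}$, then for $t=T-1,\dots,0$, $F_t^{k+1}=F_t^k\cup\{\phi_t^{\mathrm{SDDP}}(F_{t+1}^{k+1},x_t^k)\}$. $V_t^k:=\mathcal V_{F_t^k}$. The sequence $(V_t^k)_k$ is non-decreasing; $V_t^*$ denotes its limit, the convergence being uniform on every compact subset of $\mathrm{dom}(V_t)$. **Optimal trajectory for the $k$-th approximations starting from $x_0$.** $x_0^k:=x_0$ and $x_{t+1}^k:=f_t(x_t^k,u_t^k)$ where $u_t^k\in\arg\min_u\mathcal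 B_t^u(V_{t+1}^k)(x_t^k)$, $t\in\{0,\dots,T-1\}$. (For $k=0$, where all $V_t^0\equiv-\infty$, the trial points are arbitrary points $x_t^0\in X_t$.) **Set limits.** $\limsup_kC_k$ is the set of all cluster points of sequences $(y_k)$ with $y_k\in C_k$. **Optimal sets.** $(S_t)_{t\in\{0,\dots,T\}}$ is $(\phi_t)$-optimal if for every $t\in\{0,\dots,T-1\}$, $\mathcal B_t(\phi_{t+1}+\delta_{S_{t+1}})+\delta_{S_t}=\mathcal B_t(\phi_{t+1})+\delta_{S_t}$. *)

(* Defs.v *)
From HB Require Import structures.
From mathcomp Require Import all_boot all_order all_algebra.
From mathcomp Require Import all_classical all_reals all_analysis.

Set Implicit Arguments.
Unset Strict Implicit.
Unset Printing Implicit Defensive.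

Import Order.TTheory GRing.Theory Num.Theory.
Import numFieldNormedType.Exports.

Local Open Scope classical_set_scope.
Local Open Scope ring_scope.

(* The library norm on matrices is the sup norm; the Lipschitz constants and
   the bounds on slopes below refer to the Euclidean norm [norm2].  The
   topology on ['cV[R]_n] is the library one, which both norms induce. *)
Definition dotc (R : realType) (n : nat) (a x : 'cV[R]_n) : R :=
  \sum_(i < n) a i 0 * x i 0.

Definition norm2 (R : realType) (n : nat) (x : 'cV[R]_n) : R :=
  Num.sqrt (dotc x x).

Definition norm2_pair (R : realType) (n m : nat) (z : 'cV[R]_n * 'cV[R]_m) : R :=
  Num.sqrt (norm2 z.1 ^+ 2 + norm2 z.2 ^+ 2).

(* Sums of extended reals are the library's dual sums [(_ + _)%dE], for which
   (+oo) + (-oo) = +oo; the plain sum of the library takes the value -oo. *)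

Section ExtendedRealFunctions.
Context {R : realType}.

Definition edom {E : Type} (phi : E -> \bar R) : set E :=
  [set x | phi x \is a fin_num].

Definition proper_fun {E : Type} (phi : E -> \bar R) : Prop :=
  (forall x, phi x != -oo%E) /\ exists x, phi x != +oo%E.

Definition convex_efun {E : lmodType R} (phi : E -> \bar R) : Prop :=
  forall (x y : E) (s : R), 0 <= s <= 1 ->
    (phi (s *: x + (1 - s) *: y)%R <= s%:E * phi x + (1 - s)%:E * phi y)%dE.

Definition lipschitz_edom {E : zmodType} (nrm : E -> R) (C : R)
    (phi : E -> \bar R) : Prop :=
  forall x y, edom phi x -> edom phi y ->
    `|fine (phi x) - fine (phi y)| <= C * nrm (x - y).

Definition edelta {E : Type} (S : set E) (x : E) : \bar R :=
  if x \in S then 0%E else +oo%E.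

Definition argmin {E : Type} (g : E -> \bar R) : set E :=
  [set u | forall v, (g u <= g v)%E].

(* The supremum of the empty family is the constant function -oo. *)
Definition sup_fun_set {E : Type} (F : set (E -> \bar R)) (x : E) : \bar R :=
  ereal_sup [set phi x | phi in F].

Definition subdifferential {n : nat} (phi : 'cV[R]_n -> \bar R)
    (x : 'cV[R]_n) : set 'cV[R]_n :=
  [set a | forall y : 'cV[R]_n, (phi x + (dotc a (y - x))%:E <= phi y)%dE].

(* A polytope is the convex hull of a finite family of points. *)
Definition polytope {n : nat} (X : set 'cV[R]_n) : Prop :=
  exists (k : nat) (p : 'I_k -> 'cV[R]_n),
    X = [set x | exists w : 'I_k -> R,
           [/\ forall i, 0 <= w i, \sum_i w i = 1 & x = \sum_i w i *: p i]].

Definition set_limsup {E : topologicalType} (C : nat -> set E) : set E :=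
  [set z | exists y : nat -> E, (forall k, C k (y k)) /\ cluster (y @ \oo) z].

End ExtendedRealFunctions.

Record lc_problem (R : realType) (n m : nat) := LCProblem {
  horizon : nat ;
  state_mx : nat -> 'M[R]_n ;
  control_mx : nat -> 'M[R]_(n, m) ;
  cost : nat -> 'cV[R]_n * 'cV[R]_m -> \bar R ;
  final_cost : 'cV[R]_n -> \bar R
}.

Section LinearConvex.
Context {R : realType} {n m : nat}.
Implicit Types (P : lc_problem R n m) (t k : nat) (L : nat -> R).

Notation state := 'cV[R]_n.
Notation control := 'cV[R]_m.
Notation efun := ('cV[R]_n -> \bar R).

Definition dyn P t (x : state) (u : control) : state :=
  state_mx P t *m x + control_mx P t *m u.

(* X_t; only times t <= horizon are meaningful. *)
Definition state_set P t : set state :=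
  if t == horizon P then edom (final_cost P)
  else [set x | exists u, edom (cost P t) (x, u)].

Definition controls P t (x : state) : set control :=
  [set u | edom (cost P t) (x, u) /\ state_set P t.+1 (dyn P t x u)].

Definition bellman_u P t (u : control) (phi : efun) (x : state) : \bar R :=
  (cost P t (x, u) + phi (dyn P t x u))%dE.

Definition bellman P t (phi : efun) (x : state) : \bar R :=
  ereal_inf [set bellman_u P t u phi x | u in [set: control]].

Record linear_convex P (Lc LU : nat -> R) (CT : R) : Prop := {
  horizon_gt0 : (0 < horizon P)%N ;
  cost_proper : forall t, (t < horizon P)%N -> proper_fun (cost P t) ;
  cost_convex : forall t, (t < horizon P)%N -> convex_efun (cost P t) ;
  cost_lsc : forall t, (t < horizon P)%N -> lower_semicontinuous (cost P t) ;
  cost_lipschitz : forall t, (t < horizon P)%N ->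
    lipschitz_edom (@norm2_pair R n m) (Lc t) (cost P t) ;
  state_set_polytope : forall t, (t < horizon P)%N -> polytope (state_set P t) ;
  state_set_interior : forall t, (t < horizon P)%N ->
    (state_set P t)^° !=set0 ;
  controls_compact : forall t x, (t < horizon P)%N -> state_set P t x ->
    compact (controls P t x) ;
  controls_nonempty : forall t x, (t < horizon P)%N -> state_set P t x ->
    controls P t x !=set0 ;
  controls_graph_interior : forall t, (t < horizon P)%N ->
    [set z : state * control | controls P t z.1 z.2]^° !=set0 ;
  controls_lipschitz : forall t x x', (t < horizon P)%N ->
    state_set P t x -> state_set P t x' ->
    controls P t x' `<=`
      [set u + (LU t * norm2 (x' - x)) *: v
         | u in controls P t x & v in [set v | norm2 v <= 1]] ;
  final_proper : proper_fun (final_cost P) ;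
  final_convex : convex_efun (final_cost P) ;
  final_lsc : lower_semicontinuous (final_cost P) ;
  final_set_convex : convex_set (state_set P (horizon P)) ;
  final_set_compact : compact (state_set P (horizon P)) ;
  final_set_interior : (state_set P (horizon P))^° !=set0 ;
  final_lipschitz : lipschitz_edom (@norm2 R n) CT (final_cost P)
}.

Definition regular_on (X : set state) (C : R) (phi : efun) : Prop :=
  [/\ convex_efun phi, lower_semicontinuous phi, proper_fun phi,
      edom phi = X & lipschitz_edom (@norm2 R n) C phi].

Definition propagated_constants P (CT : R) L : Prop :=
  L (horizon P) = CT /\
  forall t, (t < horizon P)%N ->
    0 < L t /\
    forall phi : efun, regular_on (state_set P t.+1) (L t.+1) phi ->
      regular_on (state_set P t) (L t) (bellman P t phi).

Definition SDDP_basic P L t : set efun :=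
  [set phi | exists a b, norm2 a <= L t /\
     phi = fun x => ((dotc a x + b)%:E + edelta (state_set P t) x)%dE].

Definition SDDP_cut P t (a x : state) (b : R) : efun :=
  fun x' => ((dotc a (x' - x) + b)%:E + edelta (state_set P t) x')%dE.

(* The constraints other than x' = x, on a triple (x', u, lambda). *)
Definition SDDP_feasible P t (F : set efun) : set (state * control * R) :=
  [set z | [/\ state_set P t z.1.1, controls P t z.1.1 z.1.2 &
     forall phi, F phi -> (phi (dyn P t z.1.1 z.1.2) <= z.2%:E)%E]].

Definition SDDP_objective P t (z : state * control * R) : \bar R :=
  (cost P t z.1 + z.2%:E)%dE.

Definition SDDP_optval P t (F : set efun) (x : state) : \bar R :=
  ereal_inf [set SDDP_objective P t z
    | z in [set z | SDDP_feasible P t F z /\ z.1.1 = x]].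

Definition SDDP_lagrangian P t (x a : state) (z : state * control * R) : \bar R :=
  (SDDP_objective P t z - (dotc a (z.1.1 - x))%:E)%dE.

(* The Lagrangian is convex and nonsmooth: z is stationary, the constraints
   [SDDP_feasible] being kept, when 0 is a subgradient at z of its restriction
   to the feasible set, which unfolds to minimality of z on that set. *)
Definition SDDP_stationary P t (F : set efun) (x a : state)
    (z : state * control * R) : Prop :=
  SDDP_feasible P t F z /\
  forall z', SDDP_feasible P t F z' ->
    (SDDP_lagrangian P t x a z <= SDDP_lagrangian P t x a z')%E.

Definition SDDP_selected P L t (F : set efun) (x : state) (phi : efun) : Prop :=
  exists (a : state) (b : R) (z : state * control * R),
    [/\ SDDP_optval P t F x = b%:E,
        z.1.1 = x /\ SDDP_objective P t z = b%:E,
        SDDP_stationary P t F x a z,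
        norm2 a <= L t &
        phi = SDDP_cut P t a x b].

Definition SDDP_selected_final P L (x : state) (phi : efun) : Prop :=
  exists (a : state) (b : R),
    [/\ final_cost P x = b%:E,
        subdifferential (final_cost P) x a,
        norm2 a <= L (horizon P) &
        phi = SDDP_cut P (horizon P) a x b].

(* For t < horizon the optimal value is -oo when F is empty and may be +oo when
   F is infinite, so that a cut need not exist; the algorithm only uses finite
   nonempty F, for which it does. *)
Definition SDDP_selection P L (sel : nat -> set efun -> state -> efun) : Prop :=
  (forall t (F : set efun) (x : state), (t < horizon P)%N ->
     finite_set F -> F !=set0 -> F `<=` SDDP_basic P L t.+1 ->
     state_set P t x -> SDDP_selected P L t F x (sel t F x)) /\
  (forall (F : set efun) (x : state),
     F `<=` SDDP_basic P L (horizon P) ->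
     state_set P (horizon P) x ->
     SDDP_selected_final P L x (sel (horizon P) F x)).

(* [F k t] is F_t^k and [xs k t] is x_t^k. *)
Definition TDP_run P (sel : nat -> set efun -> state -> efun)
    (xs : nat -> nat -> state) (F : nat -> nat -> set efun) : Prop :=
  [/\ forall t, (t <= horizon P)%N -> F 0%N t = set0,
      forall k, F k.+1 (horizon P) = F k (horizon P) `|`
        [set sel (horizon P) (F k (horizon P)) (xs k (horizon P))] &
      forall k t, (t < horizon P)%N ->
        F k.+1 t = F k t `|` [set sel t (F k.+1 t.+1) (xs k t)]].

Definition optimal_trajectory P (phi : nat -> efun) (x0 : state)
    (x : nat -> state) : Prop :=
  x 0%N = x0 /\
  forall t, (t < horizon P)%N ->
    exists2 u : control,
      argmin (fun v => bellman_u P t v (phi t.+1) (x t)) u &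
      x t.+1 = dyn P t (x t) u.

(* At k = 0 all approximations are -oo and the trial points are arbitrary
   points of the sets X_t. *)
Definition trial_points P (x0 : state) (V : nat -> nat -> efun)
    (xs : nat -> nat -> state) : Prop :=
  (forall t, (t <= horizon P)%N -> state_set P t (xs 0%N t)) /\
  (forall k, (0 < k)%N -> optimal_trajectory P (V k) x0 (xs k)).

Definition optimal_sets P (phi : nat -> efun) (S : nat -> set state) : Prop :=
  forall t, (t < horizon P)%N ->
    (fun x => (bellman P t (fun y => phi t.+1 y + edelta (S t.+1) y) x
               + edelta (S t) x)%dE)
    = (fun x => (bellman P t (phi t.+1) x + edelta (S t) x)%dE).

End LinearConvex.

(* Main.v *)
Require Import Defs.
From mathcomp Require Import all_boot all_order all_algebra.
From mathcomp Require Import all_classical all_reals all_analysis.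
From mathcomp Require Import ring lra.
Import Order.TTheory GRing.Theory Num.Theory.
Import numFieldNormedType.Exports.
Import DualAddTheory.
Local Open Scope classical_set_scope.
Local Open Scope ring_scope.

(** Adding the indicator of [Kstar t.+1] can only increase the Bellman
infimum, so for a state [x] of [Kstar t] everything reduces to finding one
control which is optimal at [x] for the limit [Vstar t.+1] and which sends [x]
into [Kstar t.+1].  That control is a limit of the controls [u k] that the
algorithm plays at its trial points.

Let [x] be a cluster point of the trial points [xs k t], and assume first that
[x] lies in [state_set P t].  The set-valued map of admissible controls is
Lipschitz, so [u k] is within a vanishing distance of the compact set of
controls admissible at [x]; hence along some filter [G] finer than [\oo] both
[xs k t --> x] and [u k --> ub], with [ub] admissible at [x]
([cluster_trial_limit_control]).  By continuity of the dynamics,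
[xs k t.+1 --> dyn P t x ub] along [G], and [dyn P t x ub] is in [Kstar t.+1]
([dyn_in_limsup]).

Optimality passes to the limit ([argmin_limit]).  Given a competitor [v] at
[x], Lipschitz continuity of the admissible controls, used in the opposite
direction, provides competitors [w k] at [xs k t] with [w k --> v].
The approximations at time [t.+1] are suprema of cuts with slopes bounded by
[L t.+1], so they are Lipschitz with a common constant, and so is the cost;
the one-step cost [bellman_u] therefore varies along admissible pairs by at
most [bellman_modulus], uniformly in [k] ([bellman_u_lipschitz]).  The
inequality between [u k] and [w k] thus becomes, up to a vanishing error, an
inequality between [ub] and [v] for the [k]-th approximation at the fixed point
[x], and monotone convergence in [k] concludes.

If [x] is outside [state_set P t], no control has a finite cost and both sides
are [+oo].

It remains to know that the run makes sense ([run_well_formed]): at every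
iteration the cuts are finitely many, are basic functions, and exist from the
first iteration on.  This is proved together with the membership of the trial
points in the state sets, by induction on the iteration, going backward in time
for the cuts and forward for the trial points. *)

(** * Filters and cluster points *)

(** Plays the role of the extraction of a convergent subsequence.  The finer
filter lives on the index set, so that other families with the same indices can
be followed along it and refined again. *)
Lemma cluster_subfilter {I : Type} {T : topologicalType} (F : set_system I)
    {FF : Filter F} (f : I -> T) (p : T) : cluster (f @ F) p ->
  exists G : set_system I, [/\ ProperFilter G, F `<=` G & f @ G --> p].
Proof.
move=> Fp.
exists (filter_from [set AB | F AB.1 /\ nbhs p AB.2]
  (fun AB : set I * set T => AB.1 `&` f @^-1` AB.2)); split.
- apply: filter_from_proper; last first.
    move=> [A B] /= [FA pB].
    have fA : F (f @^-1` (f @` A)).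
      exact: filterS (@preimage_image _ _ f A) FA.
    by have [_ [[i Ai <-] Bi]] := Fp (f @` A) B fA pB; exists i.
  apply: filter_from_filter.
    by exists (setT, setT); split; exact: filterT.
  move=> [A B] [A' B'] /= [FA pB] [FA' pB'].
  exists (A `&` A', B `&` B'); first by split; exact: filterI.
  by move=> i /= [[? ?] [? ?]].
- move=> A FA; exists (A, setT) => /=; first by split=> //; exact: filterT.
  by rewrite preimage_setT setIT.
- move=> B pB; exists (setT, B) => /=; first by split=> //; exact: filterT.
  by rewrite setTI.
Qed.

(** * The Euclidean norm *)

Section EuclideanNorm.
Context {R : realType}.

Lemma dotcC {n} (x y : 'cV[R]_n) : dotc x y = dotc y x.
Proof. by apply: eq_bigr => i _; rewrite mulrC. Qed.

Lemma dotcDl {n} (x y z : 'cV[R]_n) : dotc (x + y) z = dotc x z + dotc y z.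
Proof. by rewrite -big_split; apply: eq_bigr => i _; rewrite mxE mulrDl. Qed.

Lemma dotcZl {n} (c : R) (x y : 'cV[R]_n) : dotc (c *: x) y = c * dotc x y.
Proof.
by rewrite /dotc mulr_sumr; apply: eq_bigr => i _; rewrite mxE mulrA.
Qed.

Lemma dotcDr {n} (x y z : 'cV[R]_n) : dotc x (y + z) = dotc x y + dotc x z.
Proof. by rewrite !(dotcC x) dotcDl. Qed.

Lemma dotcBr {n} (x y z : 'cV[R]_n) : dotc x (y - z) = dotc x y - dotc x z.
Proof.
by rewrite dotcDr -[- z]scaleN1r (dotcC _ (_ *: _)) dotcZl mulN1r (dotcC z).
Qed.

Lemma dotc_ge0 {n} (x : 'cV[R]_n) : 0 <= dotc x x.
Proof. by apply: sumr_ge0 => i _; rewrite -expr2 sqr_ge0. Qed.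

Lemma norm2_ge0 {n} (x : 'cV[R]_n) : 0 <= norm2 x.
Proof. exact: sqrtr_ge0. Qed.

Lemma sqr_norm2 {n} (x : 'cV[R]_n) : norm2 x ^+ 2 = dotc x x.
Proof. by rewrite sqr_sqrtr ?dotc_ge0. Qed.

Lemma norm2_0 n : norm2 (0 : 'cV[R]_n) = 0.
Proof.
by rewrite /norm2 /dotc big1 ?sqrtr0 // => i _; rewrite mxE mul0r.
Qed.

Lemma norm_le_norm2 {n} (x : 'cV[R]_n) : `|x| <= norm2 x.
Proof.
rewrite [leLHS]/Num.Def.normr/= mx_normrE.
apply: bigmax_le => [|[i j] _] /=; first exact: norm2_ge0.
rewrite ord1 -sqrtr_sqr ler_sqrt ?dotc_ge0 // /dotc (bigD1 i) //= -expr2.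
by rewrite lerDl sumr_ge0 // => l _; rewrite -expr2 sqr_ge0.
Qed.

(** The Cauchy-Schwarz inequality, from the nonnegativity of the quadratic
polynomial [s |-> dotc (a - s *: x) (a - s *: x)]. *)
Lemma dotc_le_norm2 {n} (a x : 'cV[R]_n) : dotc a x <= norm2 a * norm2 x.
Proof.
have H (s : R) : 0 <= dotc a a - 2 * s * dotc a x + s ^+ 2 * dotc x x.
  have := dotc_ge0 (a + (- s) *: x).
  rewrite dotcDl !dotcDr !dotcZl !(dotcC _ (_ *: _)) !dotcZl (dotcC x a).
  by congr (_ <= _); ring.
have [xx0|xx0] := eqVneq (dotc x x) 0.
  rewrite {2}/norm2 xx0 sqrtr0 mulr0 leNgt; apply/negP => ax0.
  (* When [dotc x x = 0] the polynomial is affine, with slope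
     [- 2 * dotc a x]; at this argument it takes the value -1. *)
  have := H ((dotc a a + 1) / (2 * dotc a x)).
  rewrite xx0 mulr0 addr0 (_ : _ - _ = - 1 :> R); last first.
    by field; rewrite gt_eqF.
  by rewrite ler0N1.
have xx_gt0 : 0 < dotc x x by rewrite lt_def xx0 dotc_ge0.
have [ax0|ax0] := leP (dotc a x) 0.
  by apply: le_trans ax0 _; rewrite mulr_ge0 ?norm2_ge0.
rewrite -(ler_pXn2r (ltn0Sn 1)) ?nnegrE ?mulr_ge0 ?norm2_ge0 ?(ltW ax0) //.
rewrite exprMn !sqr_norm2 -subr_ge0.
(* The minimizer of the polynomial. *)
have := H (dotc a x / dotc x x).
rewrite (_ : _ + _ = (dotc a a * dotc x x - dotc a x ^+ 2) / dotc x x).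
  by rewrite pmulr_lge0 ?invr_gt0.
by field; exact: lt0r_neq0.
Qed.

Lemma norm2_continuous {n} : continuous (@norm2 R n).
Proof.
move=> x; apply: (@continuous_comp _ _ _ (fun x : 'cV[R]_n => dotc x x)) => /=.
  apply: (@cvg_big R^o 'I_n _ 0 xpredT _ _ (nbhs x)) => [z|i _].
    exact: (@add_continuous R^o).
  by apply: cvgM; apply: coord_continuous.
exact: sqrt_continuous.
Qed.

Lemma mulmx_continuous p q (A : 'M[R]_(p, q)) :
  continuous (fun x : 'cV[R]_q => A *m x).
Proof.
pose C := \sum_i \sum_j `|A i j|.
have C_ge0 : 0 <= C by apply: sumr_ge0 => i _; apply: sumr_ge0.
have bound (x : 'cV[R]_q) : `|A *m x| <= C * `|x|.
  rewrite [leLHS]/Num.Def.normr/= mx_normrE.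
  apply: bigmax_le => [|[i j] _] /=; first by rewrite mulr_ge0.
  rewrite mxE (le_trans (ler_norm_sum _ _ _)) // /C mulr_suml (bigD1 i) //=.
  apply: ler_wpDr.
    by apply: sumr_ge0 => k _; rewrite mulr_ge0 // sumr_ge0.
  rewrite mulr_suml; apply: ler_sum => l _; rewrite normrM ler_wpM2l //.
  rewrite [leRHS]/Num.Def.normr/= mx_normrE.
  by apply/bigmax_geP; right => /=; exists (l, j).
apply: (@bounded_linear_continuous _ _ _ (mulmx A)).
apply/linear_boundedP; exists C; split; first exact: ger0_real.
by move=> r /ltW Cr x; rewrite (le_trans (bound x)) // ler_wpM2r.
Qed.

Lemma norm2N {n} (x : 'cV[R]_n) : norm2 (- x) = norm2 x.
Proof.
rewrite /norm2 /dotc; congr Num.sqrt; apply: eq_bigr => i _.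
by rewrite mxE mulrNN.
Qed.

Lemma norm2_pairN {n m} (z : 'cV[R]_n * 'cV[R]_m) :
  norm2_pair (- z) = norm2_pair z.
Proof. by rewrite /norm2_pair !norm2N. Qed.

Lemma norm2_cvg0 {n} {I : Type} (G : set_system I) {FG : Filter G}
    (f : I -> 'cV[R]_n) (a : 'cV[R]_n) :
  f @ G --> a -> norm2 (a - f i) @[i --> G] --> 0.
Proof.
move=> fa; rewrite -(norm2_0 n) -(subrr a).
apply: (@continuous_cvg _ _ _ G _ _ (@norm2 R n)).
  exact: norm2_continuous.
by apply: cvgB => //; exact: cvg_cst.
Qed.

Lemma norm2_pair_cvg0 {n m} {I : Type} (G : set_system I) {FG : Filter G}
    (f : I -> 'cV[R]_n) (g : I -> 'cV[R]_m) (a : 'cV[R]_n) (b : 'cV[R]_m) :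
  f @ G --> a -> g @ G --> b ->
  norm2_pair ((a, b) - (f i, g i)) @[i --> G] --> 0.
Proof.
move=> /norm2_cvg0 fa /norm2_cvg0 gb.
rewrite -(sqrtr0 R); apply: (@continuous_cvg _ _ _ G _ _ Num.sqrt).
  exact: sqrt_continuous.
rewrite -[X in _ --> X](addr0 0) -[X in _ --> X + _](mulr0 0).
rewrite -[X in _ --> _ + X](mulr0 0).
by apply: cvgD; apply: cvgM.
Qed.

End EuclideanNorm.

(** * Extended-real Lipschitz functions and SDDP cuts *)

Section ExtendedLipschitz.
Set Implicit Arguments.
Unset Strict Implicit.
Context {R : realType} {n : nat}.
Notation efun := ('cV[R]_n -> \bar R).

(** Lipschitz continuity as a one-sided inequality in the extended reals: in
this form it passes to suprema of functions without separating the question of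
their finiteness.  By exchanging the points it gives the usual absolute
value. *)
Definition elipschitz_on (X : set 'cV[R]_n) (M : R) (W : efun) : Prop :=
  [/\ forall x, X x -> W x \is a fin_num,
      forall x, ~ X x -> W x = +oo%E &
      forall x y, X x -> X y -> (W x <= W y + (M * norm2 (x - y))%:E)%dE].

Lemma sup_fun_setS (F G : set efun) x :
  F `<=` G -> (sup_fun_set F x <= sup_fun_set G x)%E.
Proof.
by move=> FG; apply: le_ereal_sup => _ [phi /FG Gphi <-]; exists phi.
Qed.

Lemma sup_fun_set_ub (F : set efun) phi x :
  F phi -> (phi x <= sup_fun_set F x)%E.
Proof. by move=> Fphi; apply: ereal_sup_ubound; exists phi. Qed.

Lemma sup_fun_set_lty (F : set efun) x : finite_set F ->
  (forall phi, F phi -> phi x < +oo)%E -> (sup_fun_set F x < +oo)%E.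
Proof.
move=> /finite_seqP[s ->] sx.
suff [r sr] : exists r : R, forall phi, phi \in s -> (phi x <= r%:E)%E.
  rewrite (@le_lt_trans _ _ r%:E) ?ltry //.
  by apply: ge_ereal_sup => _ [phi /sr + <-].
elim: s sx => [|phi s IHs] sx; first by exists 0.
have [psi /= spsi|r sr] := IHs; first by apply: sx; rewrite /= inE spsi orbT.
have : (phi x < +oo)%E by apply: sx; rewrite /= mem_head.
case E : (phi x) => [q||] // _.
- exists (Num.max q r) => psi; rewrite inE => /predU1P[->|/sr psir].
    by rewrite E lee_fin le_max lexx.
  by rewrite (le_trans psir) // lee_fin le_max lexx orbT.
- by exists r => psi; rewrite inE => /predU1P[->|/sr //]; rewrite E leNye.
Qed.

End ExtendedLipschitz.

Section Problem.
Set Implicit Arguments.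
Unset Strict Implicit.
Context {R : realType} {n m : nat}.
Implicit Types (P : lc_problem R n m) (L : nat -> R).
Notation efun := ('cV[R]_n -> \bar R).

Lemma SDDP_cut_basic P L t a x b : norm2 a <= L t ->
  SDDP_basic P L t (SDDP_cut P t a x b).
Proof.
move=> aL; exists a, (b - dotc a x); split => //; apply/funext => y.
by rewrite /SDDP_cut dotcBr addrA addrAC.
Qed.

Lemma basic_lipschitz P L t phi : SDDP_basic P L t phi ->
  elipschitz_on (state_set P t) (L t) phi.
Proof.
move=> [a [b [aL ->]]]; rewrite /edelta; split=> [x Xx|x Xx|x y Xx Xy].
- by rewrite mem_set // dadde0.
- by rewrite memNset // daddey.
- rewrite !mem_set // !dadde0 -dEFinD lee_fin.
  have : dotc a (x - y) <= L t * norm2 (x - y).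
    by rewrite (le_trans (dotc_le_norm2 _ _)) // ler_wpM2r ?norm2_ge0.
  by rewrite dotcBr; lra.
Qed.

(** A supremum keeps a Lipschitz constant common to all the functions;
finiteness of the family bounds the supremum above and its nonemptiness bounds
it below. *)
Lemma sup_basic_lipschitz P L t (F : set efun) :
  finite_set F -> F !=set0 -> F `<=` SDDP_basic P L t ->
  elipschitz_on (state_set P t) (L t) (sup_fun_set F).
Proof.
move=> Ffin [phi0 Fphi0] Fbasic.
have Flip phi : F phi -> elipschitz_on (state_set P t) (L t) phi.
  by move=> /Fbasic; exact: basic_lipschitz.
split=> [x Xx|x Xx|x y Xx Xy].
- rewrite fin_numElt; apply/andP; split.
    apply: lt_le_trans (sup_fun_set_ub x Fphi0).
    by have [/(_ x Xx)/fin_numPlt/andP[]] := Flip _ Fphi0.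
  apply: sup_fun_set_lty => // phi /Flip[/(_ x Xx)].
  by rewrite fin_numElt => /andP[].
- apply/eqP; rewrite -leye_eq; have [_ /(_ x Xx) <- _] := Flip _ Fphi0.
  exact: sup_fun_set_ub.
- apply: ge_ereal_sup => _ [phi Fphi <-].
  have [_ _ /(_ x y Xx Xy) /le_trans] := Flip _ Fphi; apply.
  by apply: lee_dD2r; exact: sup_fun_set_ub.
Qed.

(** The bound does not mention the function [W] to which the Bellman operator is
applied, only its Lipschitz constant [M]; this is what makes the estimates
uniform over the iterations of the algorithm. *)
Definition bellman_modulus P t (Lc M : R) (x x' : 'cV[R]_n)
    (u u' : 'cV[R]_m) : R :=
  Lc * norm2_pair ((x, u) - (x', u')) + M * norm2 (dyn P t x u - dyn P t x' u').

Lemma bellman_u_lipschitz P t Lc M W x x' u u' :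
  lipschitz_edom (@norm2_pair R n m) Lc (cost P t) ->
  elipschitz_on (state_set P t.+1) M W ->
  controls P t x u -> controls P t x' u' ->
  (bellman_u P t u W x <=
   bellman_u P t u' W x' + (bellman_modulus P t Lc M x x' u u')%:E)%dE.
Proof.
move=> clip [Wfin _ Wlip] [cu Xu] [cu' Xu'].
rewrite /bellman_u /bellman_modulus dEFinD.
apply: (@le_trans _ _
  ((cost P t (x', u') + (Lc * norm2_pair ((x, u) - (x', u')))%:E) +
   (W (dyn P t x' u') + (M * norm2 (dyn P t x u - dyn P t x' u'))%:E))%dE).
  apply: lee_dD; last exact: Wlip.
  have := clip _ _ cu cu'; rewrite -(fineK cu) -(fineK cu') -dEFinD lee_fin /=.
  by rewrite -lerBlDl => /(le_trans (ler_norm _)).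
by rewrite daddeACA.
Qed.

Lemma dyn_cvg P t {I : Type} (G : set_system I) {FG : Filter G}
    (x : I -> 'cV[R]_n) (u : I -> 'cV[R]_m) a b :
  x @ G --> a -> u @ G --> b -> dyn P t (x i) (u i) @[i --> G] --> dyn P t a b.
Proof.
move=> xa ub; apply: cvgD.
  apply: (@continuous_cvg _ _ _ G _ _ (mulmx (state_mx P t))) xa.
  exact: mulmx_continuous.
apply: (@continuous_cvg _ _ _ G _ _ (mulmx (control_mx P t))) ub.
exact: mulmx_continuous.
Qed.

Lemma bellman_modulusC P t Lc M x x' u u' :
  bellman_modulus P t Lc M x x' u u' = bellman_modulus P t Lc M x' x u' u.
Proof.
by rewrite /bellman_modulus -norm2_pairN -norm2N !opprB.
Qed.

Lemma bellman_modulus_cvg0 P t Lc M {I : Type} (G : set_system I)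
    {FG : Filter G} (x : I -> 'cV[R]_n) (u : I -> 'cV[R]_m) a b :
  x @ G --> a -> u @ G --> b ->
  bellman_modulus P t Lc M a (x i) b (u i) @[i --> G] --> 0.
Proof.
move=> xa ub; rewrite -[X in _ --> X](addr0 0) -[X in _ --> X + _](mulr0 Lc).
rewrite -[X in _ --> _ + X](mulr0 M); apply: cvgD; apply: cvgMr.
  exact: norm2_pair_cvg0.
by apply: norm2_cvg0; exact: dyn_cvg.
Qed.

End Problem.

(** * Controls and the limit of minimizers *)

Section Dynamics.
Set Implicit Arguments.
Unset Strict Implicit.
Context {R : realType} {n m : nat} {P : lc_problem R n m}.
Context {Lc LU : nat -> R} {CT : R} (hP : linear_convex P Lc LU CT).
Notation efun := ('cV[R]_n -> \bar R).

(** Constraints are encoded by infinite values: an inadmissible control leaves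
the domain either of the cost or, through the dynamics, of [W]. *)
Lemma bellman_u_notin t x u (W : efun) : (t < horizon P)%N ->
  (forall y, ~ state_set P t.+1 y -> W y = +oo%E) ->
  ~ controls P t x u -> bellman_u P t u W x = +oo%E.
Proof.
move=> tT Wy; rewrite /bellman_u.
have [cu nu|cu _] := pselect (edom (cost P t) (x, u)).
  by rewrite Wy ?daddey // => Xy; apply: nu.
have [/(_ (x, u)) cNy _] := cost_proper hP tT.
suff -> : cost P t (x, u) = +oo%E by rewrite daddye.
apply/eqP; move: cu cNy; rewrite /edom /= fin_numE.
by case: eqVneq => //= _ /negP; rewrite negbK.
Qed.

Lemma bellman_u_fin_num t M x u (W : efun) :
  elipschitz_on (state_set P t.+1) M W -> controls P t x u ->
  bellman_u P t u W x \is a fin_num.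
Proof. by move=> [Wfin _ _] [cu Xu]; rewrite /bellman_u dfin_numD cu Wfin. Qed.

(** Some admissible control exists and has a finite value, so a minimizer has a
finite value too, and hence is admissible. *)
Lemma argmin_controls t M x u (W : efun) : (t < horizon P)%N ->
  elipschitz_on (state_set P t.+1) M W -> state_set P t x ->
  argmin (fun v => bellman_u P t v W x) u -> controls P t x u.
Proof.
move=> tT Wlip Xx umin; apply: contrapT => nu.
have [v xv] := controls_nonempty hP tT Xx.
have := umin v; rewrite (bellman_u_notin tT _ nu); last by case: Wlip.
have /fin_numPlt/andP[_ /lt_eqF] := bellman_u_fin_num Wlip xv.
by rewrite leye_eq => ->.
Qed.

(** The Lipschitz property of the admissible controls, along a filter.  It is
used in two directions: from trial points to a limit state, to bring the played
controls close to a compact set, and from the limit state to trial points, to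
transport a competing control. *)
Lemma controls_near {I : Type} (G : set_system I) {FG : Filter G} t
    (x x' : I -> 'cV[R]_n) (u : I -> 'cV[R]_m) :
  (t < horizon P)%N -> norm2 (x i - x' i) @[i --> G] --> 0 ->
  (\forall i \near G, controls P t (x i) (u i)) ->
  (\forall i \near G, state_set P t (x i)) ->
  (\forall i \near G, state_set P t (x' i)) ->
  exists2 u' : I -> 'cV[R]_m, \forall i \near G, controls P t (x' i) (u' i) &
    u i - u' i @[i --> G] --> (0 : 'cV[R]_m).
Proof.
move=> tT xx' xu Xx Xx'.
pose admissible i := [/\ controls P t (x i) (u i), state_set P t (x i) &
  state_set P t (x' i)].
have near_admissible : \forall i \near G, admissible i.
  by near=> i; split; near: i.
(* At inadmissible indices [u' i] is the default value 0. *)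
have /choice[u' u'P] i : exists v, admissible i ->
    controls P t (x' i) v /\ `|u i - v| <= `|LU t * norm2 (x i - x' i)|.
  have [[ui Xi Xi']|//] := pselect (admissible i); last by exists 0.
  have [v xv [w /= w1 uE]] := controls_lipschitz hP tT Xi' Xi ui.
  exists v => _; split => //; rewrite -uE addrC addKr normrZ.
  by rewrite ler_piMr // (le_trans (norm_le_norm2 _)).
exists u'; first by apply: filterS near_admissible => i /u'P[].
apply/norm_cvg0P.
apply: (@squeeze_cvgr _ _ _ _ (cst 0) (fun i => `|LU t * norm2 (x i - x' i)|)).
- by apply: filterS near_admissible => i /u'P[_ ->]; rewrite normr_ge0.
- exact: cvg_cst.
- by rewrite -(normr0 R) -(mulr0 (LU t)); apply: cvg_norm; exact: cvgMr.
Unshelve. all: by end_near. Qed.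

(** Minimizers pass to the limit even though the minimized functions change with
[k]: both the minimizer [u k] and a competitor [w k] can be moved to the fixed
state [xb] at a cost bounded by [bellman_modulus], which vanishes and does not
depend on [W k].  What is left is a comparison at [xb], where pointwise
convergence of [W k] suffices. *)
Lemma argmin_limit (G : set_system nat) {FG : ProperFilter G} t M
    (W : nat -> efun) (Wlim : efun)
    (x : nat -> 'cV[R]_n) (u : nat -> 'cV[R]_m)
    (xb : 'cV[R]_n) (ub : 'cV[R]_m) :
  (t < horizon P)%N ->
  (forall y, W k y @[k --> G] --> Wlim y) ->
  (forall k y, (W k y <= Wlim y)%E) ->
  (\forall k \near G, elipschitz_on (state_set P t.+1) M (W k)) ->
  (\forall k \near G, state_set P t (x k)) ->
  (\forall k \near G, argmin (fun v => bellman_u P t v (W k) (x k)) (u k)) ->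
  x @ G --> xb -> u @ G --> ub ->
  state_set P t xb -> controls P t xb ub ->
  argmin (fun v => bellman_u P t v Wlim xb) ub.
Proof.
move=> tT Wcvg Wle Wlip Xx umin xxb uub Xxb xbub v.
have [xbv|nv] := pselect (controls P t xb v); last first.
  rewrite (bellman_u_notin tT _ nv) ?leey // => y Xy.
  apply/eqP; rewrite -leye_eq; have [k [_ Wy _]] := filter_ex Wlip.
  by rewrite -(Wy y Xy) Wle.
have xu : \forall k \near G, controls P t (x k) (u k).
  near=> k; apply: (@argmin_controls t M (x k) (u k) (W k) tT); near: k.
  - exact: Wlip.
  - exact: Xx.
  - exact: umin.
(* Transport of the competitor [v] to the states [x k]. *)
have [||||w xw wv] := @controls_near _ G _ t (cst xb) x (cst v) tT.
- exact: norm2_cvg0.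
- exact: nearW.
- exact: nearW.
- by [].
have {wv}wv : w @ G --> v.
  rewrite (_ : w = (fun k => v - (v - w k))); last first.
    by apply/funext => k; rewrite opprB addrC subrK.
  by rewrite -[X in _ --> X]subr0; apply: cvgB wv; exact: cvg_cst.
apply/lee_daddgt0Pr => e e_gt0; have e2_gt0 : 0 < e / 2 by rewrite divr_gt0.
have cost_fin : cost P t (xb, ub) \is a fin_num by case: xbub.
(* Only [Wlim] on the left is written as a limit; on the right [W k] is bounded
   by [Wlim], which may be infinite. *)
rewrite /bellman_u -lee_dsubr_addl //; apply: cvge_le (Wcvg _).
near=> k; rewrite lee_dsubr_addl //.
have Wk : elipschitz_on (state_set P t.+1) M (W k) by near: k.
have clip := cost_lipschitz hP tT.
apply: (@le_trans _ _ (bellman_u P t v (W k) xb + e%:E)%dE); last first.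
  by apply: lee_dD2r; apply: lee_dD2l; exact: Wle.
have xuk : controls P t (x k) (u k) by near: k.
have xwk : controls P t (x k) (w k) by near: k.
apply: le_trans (bellman_u_lipschitz clip Wk xbub xuk) _.
apply: (@le_trans _ _ (bellman_u P t (w k) (W k) (x k) + (e / 2)%:E)%dE).
  apply: lee_dD; first by near: k; apply: filterS umin => k; exact.
  rewrite lee_fin; near: k; apply: cvgr_le e2_gt0.
  exact: bellman_modulus_cvg0.
rewrite {2}(splitr e) dEFinD daddeA; apply: lee_dD2r.
apply: le_trans (bellman_u_lipschitz clip Wk xwk xbv) _.
apply: lee_dD2l; rewrite lee_fin bellman_modulusC; near: k.
by apply: cvgr_le e2_gt0; exact: bellman_modulus_cvg0.
Unshelve. all: by end_near. Qed.

End Dynamics.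

(** * The run of the algorithm *)

Section Run.
Set Implicit Arguments.
Unset Strict Implicit.
Context {R : realType} {n m : nat} {P : lc_problem R n m}.
Context {Lc LU : nat -> R} {CT : R} (hP : linear_convex P Lc LU CT).
Notation efun := ('cV[R]_n -> \bar R).
Context {L : nat -> R} {x0 : 'cV[R]_n} (hx0 : state_set P 0 x0).
Context {sel : nat -> set efun -> 'cV[R]_n -> efun}.
Context (hsel : SDDP_selection P L sel).
Context {F : nat -> nat -> set efun} {xs : nat -> nat -> 'cV[R]_n}.
Context (hF : TDP_run P sel xs F).
Context (hxs : trial_points P x0 (fun k t => sup_fun_set (F k t)) xs).

(** These are the conditions under which the selection functions are specified;
at iteration 0 there is no cut yet. *)
Definition well_formed_at k t : Prop :=
  [/\ finite_set (F k t), F k t `<=` SDDP_basic P L t &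
      (0 < k)%N -> F k t !=set0].
Definition well_formed k : Prop :=
  forall t, (t <= horizon P)%N -> well_formed_at k t.

Lemma well_formed_lipschitz k t :
  well_formed k -> (0 < k)%N -> (t <= horizon P)%N ->
  elipschitz_on (state_set P t) (L t) (sup_fun_set (F k t)).
Proof.
by move=> wf k_gt0 /wf[Ffin Fbasic /(_ k_gt0) F0]; exact: sup_basic_lipschitz.
Qed.

Lemma trial_controls k t u : well_formed k -> (0 < k)%N -> (t < horizon P)%N ->
  state_set P t (xs k t) ->
  argmin (fun v => bellman_u P t v (sup_fun_set (F k t.+1)) (xs k t)) u ->
  controls P t (xs k t) u.
Proof.
move=> wf k_gt0 tT; apply: (argmin_controls hP tT).
exact: well_formed_lipschitz wf k_gt0 tT.
Qed.

(** The trial points of one iteration stay in the state sets because minimizing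
controls are admissible; at iteration 0 this is an assumption. *)
Lemma trial_state_set k t : well_formed k -> (t <= horizon P)%N ->
  state_set P t (xs k t).
Proof.
move=> wf; have [k0|k_gt0] := posnP k; first by rewrite k0; apply: hxs.1.
have [xs0 step] := hxs.2 k k_gt0.
elim: t => [|t IHt] tT; first by rewrite xs0.
have [u umin ->] := step t tT.
by have [] := trial_controls wf k_gt0 tT (IHt (ltnW tT)) umin.
Qed.

Lemma well_formed_step k t phi : well_formed_at k t -> SDDP_basic P L t phi ->
  F k.+1 t = F k t `|` [set phi] -> well_formed_at k.+1 t.
Proof.
move=> [Ffin Fb _] phib FE; rewrite /well_formed_at FE.
split=> [|psi [/Fb //|-> //]|_].
  by rewrite finite_setU; split.
by exists phi; right.
Qed.

(** Within one iteration the induction goes backward in time, as the cut at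
time [t] is selected from the cuts just computed at time [t.+1]. *)
Lemma run_well_formed k : well_formed k.
Proof.
have [F0 FT Ft] := hF.
elim: k => [|k IHk] t tT.
  by rewrite /well_formed_at F0 //; split=> //; exact: finite_set0.
have [j] : exists j, (t + j = horizon P)%N.
  by exists (horizon P - t)%N; rewrite subnKC.
elim: j t tT => [|j IHj] t tT tjT.
  rewrite addn0 in tjT; rewrite tjT.
  have wfT := IHk _ (leqnn (horizon P)); have [_ Fb _] := wfT.
  apply: well_formed_step wfT _ (FT k).
  have [a [b [_ _ aL ->]]] := hsel.2 _ _ Fb (trial_state_set IHk (leqnn _)).
  exact: SDDP_cut_basic.
have tT1 : (t < horizon P)%N by rewrite -tjT -[X in (X < _)%N]addn0 ltn_add2l.
apply: well_formed_step (IHk t tT) _ (Ft k t tT1).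
have [Ffin Fb Fn0] : well_formed_at k.+1 t.+1.
  by apply: IHj => //; rewrite addSnnS.
have [a [b [z [_ _ _ aL ->]]]] :=
  hsel.1 _ _ _ tT1 Ffin (Fn0 isT) Fb (trial_state_set IHk tT).
exact: SDDP_cut_basic.
Qed.

Lemma run_nondecreasing t : (t <= horizon P)%N ->
  forall k l, (k <= l)%N -> F k t `<=` F l t.
Proof.
move=> tT k l /subnKC <-; have [_ FT Ft] := hF.
elim: (l - k)%N => [|j IHj]; first by rewrite addn0.
rewrite addnS; apply: (subset_trans IHj).
move: tT; rewrite leq_eqVlt => /predU1P[->|tT]; first by rewrite FT; left.
by rewrite Ft //; left.
Qed.

(** The played controls [u k] need not lie in the compact set of controls
admissible at [xb], but they are asymptotically close to controls [u' k] which
do; a cluster point of the latter is then a limit of the former. *)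
Lemma cluster_trial_limit_control t (xb : 'cV[R]_n) : (t < horizon P)%N ->
  state_set P t xb -> cluster ((fun k => xs k t) @ \oo) xb ->
  exists2 ub : 'cV[R]_m, controls P t xb ub &
  exists u : nat -> 'cV[R]_m, exists G : set_system nat,
    [/\ ProperFilter G, \oo `<=` G,
       xs k t @[k --> G] --> xb /\ u @ G --> ub &
       \forall k \near G,
         argmin (fun v => bellman_u P t v (sup_fun_set (F k t.+1)) (xs k t))
           (u k) /\
         xs k t.+1 = dyn P t (xs k t) (u k)].
Proof.
move=> tT Xxb /cluster_subfilter[G [FG ooG xxb]].
have /choice[u uP] k : exists v, (0 < k)%N ->
    argmin (fun v => bellman_u P t v (sup_fun_set (F k t.+1)) (xs k t)) v /\
    xs k t.+1 = dyn P t (xs k t) v.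
  have [k0|/hxs.2[_ /(_ t tT)[v vmin vE]]] := posnP k.
    by exists 0; rewrite k0.
  by exists v.
have k_gt0 : \forall k \near \oo, (0 < k)%N by exact: nbhs_infty_ge.
have xX k : state_set P t (xs k t).
  by apply: trial_state_set (ltnW tT); exact: run_well_formed.
have xu : \forall k \near G, controls P t (xs k t) (u k).
  apply: ooG; apply: filterS k_gt0 => k k0.
  by apply: trial_controls => //; [exact: run_well_formed | exact: (uP k k0).1].
have [||||u' xbu' uu'] := @controls_near _ _ _ _ _ _ _ hP _ G _ t
  (fun k => xs k t) (cst xb) u tT.
- by under eq_fun do rewrite -norm2N opprB; exact: norm2_cvg0.
- exact: xu.
- exact: nearW.
- exact: nearW.
have [ub [xbub /cluster_subfilter[H [FH GH u'ub]]]] :=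
  controls_compact hP tT Xxb (fmap_proper_filter u' FG) xbu'.
exists ub => //; exists u, H; split=> //.
- exact: subset_trans GH.
- split; first exact: cvg_trans (fun A => @GH _) xxb.
  rewrite (_ : u = (fun k => (u k - u' k) + u' k)).
    rewrite -[X in _ --> X]add0r; apply: cvgD => //.
    exact: cvg_trans (fun A => @GH _) uu'.
  by apply/funext => k; rewrite subrK.
- by apply: GH; apply: ooG; apply: filterS k_gt0 => k /uP.
Qed.

(** A limit along a filter finer than [\oo] is a cluster point of the whole
sequence. *)
Lemma dyn_in_limsup t (G : set_system nat) {FG : ProperFilter G}
    (u : nat -> 'cV[R]_m) (xb : 'cV[R]_n) (ub : 'cV[R]_m) : \oo `<=` G ->
  xs k t @[k --> G] --> xb -> u @ G --> ub ->
  (\forall k \near G, xs k t.+1 = dyn P t (xs k t) (u k)) ->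
  cluster ((fun k => xs k t.+1) @ \oo) (dyn P t xb ub).
Proof.
move=> ooG xxb uub xsE A B /ooG GA yB.
have GB : G [set k | B (dyn P t (xs k t) (u k))].
  exact: (dyn_cvg (P := P) (t := t) xxb uub).
have [k [[Ak Bk] xk]] := filter_ex (filterI (filterI GA GB : G _) xsE).
by exists (xs k t.+1); split => //; rewrite xk.
Qed.

End Run.

(** * Optimality of the limit sets *)

Section Bellman.
Set Implicit Arguments.
Unset Strict Implicit.
Context {R : realType} {n m : nat} {P : lc_problem R n m}.
Notation efun := ('cV[R]_n -> \bar R).

Lemma bellman_le t (phi psi : efun) x : (forall y, (phi y <= psi y)%E) ->
  (bellman P t phi x <= bellman P t psi x)%E.
Proof.
move=> le_phi; apply: le_ereal_inf_tmp => _ [u _ <-].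
apply: (@le_trans _ _ (bellman_u P t u phi x)).
  by apply: ereal_inf_lbound; exists u.
exact: lee_dD2l.
Qed.

Lemma bellman_argmin t (phi : efun) x u :
  argmin (fun v => bellman_u P t v phi x) u ->
  bellman P t phi x = bellman_u P t u phi x.
Proof.
move=> umin; apply/eqP; rewrite eq_le; apply/andP; split.
  by apply: ereal_inf_lbound; exists u.
by apply: le_ereal_inf_tmp => _ [v _ <-]; exact: umin.
Qed.

End Bellman.

Theorem proposition20 (R : realType) (n m : nat) (P : lc_problem R n m)
    (Lc LU : nat -> R) (CT : R) (L : nat -> R) (x0 : 'cV[R]_n)
    (sel : nat -> set ('cV[R]_n -> \bar R) -> 'cV[R]_n -> 'cV[R]_n -> \bar R)
    (F : nat -> nat -> set ('cV[R]_n -> \bar R))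
    (xs : nat -> nat -> 'cV[R]_n)
    (V : nat -> nat -> 'cV[R]_n -> \bar R)
    (Vstar : nat -> 'cV[R]_n -> \bar R)
    (K : nat -> nat -> set 'cV[R]_n)
    (Kstar : nat -> set 'cV[R]_n)
    (hP : linear_convex P Lc LU CT)
    (hx0 : state_set P 0 x0)
    (hL : propagated_constants P CT L)
    (hsel : SDDP_selection P L sel)
    (hF : TDP_run P sel xs F)
    (hV : forall k t, V k t = sup_fun_set (F k t))
    (hxs : trial_points P x0 V xs)
    (hVstar : forall t x, (t <= horizon P)%N ->
       (fun k => V k t x) @ \oo --> Vstar t x)
    (hK : forall k t, K k t = [set xs k t])
    (hKstar : forall t, Kstar t = set_limsup (fun k => K k t)) :
  optimal_sets P Vstar Kstar.
Proof.
have KstarE t : Kstar t = cluster ((fun k => xs k t) @ \oo).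
  rewrite hKstar; apply/seteqP; split=> [z [y [yK yz]]|z xz].
    rewrite (_ : (fun k => xs k t) = y) //; apply/funext => k.
    by have := yK k; rewrite hK.
  by exists (fun k => xs k t); split => // k; rewrite hK.
have {hV}VE : V = (fun k t => sup_fun_set (F k t)).
  by apply/funext => k; apply/funext => t; exact: hV.
rewrite {V}VE in hxs hVstar.
move=> t tT; apply/funext => x.
have [Kx|nKx] := pselect (Kstar t x); last first.
  by rewrite /edelta memNset // !daddey.
rewrite /edelta mem_set // !dadde0; apply/eqP; rewrite eq_le andbC.
apply/andP; split.
  by apply: bellman_le => y; case: ifP => _; rewrite ?dadde0 ?daddey ?leey.
have wf := run_well_formed hP hx0 hsel hF hxs.
have Vle k y : (sup_fun_set (F k t.+1) y <= Vstar t.+1 y)%E.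
  apply: cvge_ge (hVstar t.+1 y tT).
  near=> l; apply: sup_fun_setS; apply: (run_nondecreasing hF tT).
  by near: l; exact: nbhs_infty_ge.
(* A cluster point outside the state set: every control costs [+oo]. *)
have [Xx|nXx] := pselect (state_set P t x); last first.
  rewrite [leRHS](_ : _ = +oo%E) ?leey //; apply/eqP; rewrite -leye_eq.
  apply: le_ereal_inf_tmp => _ [u _ <-].
  rewrite (bellman_u_notin hP tT) //.
    move=> y Xy.
    have lip := well_formed_lipschitz (wf 1%N) (ltn0Sn 0) tT.
    by apply/eqP; rewrite -leye_eq; have [_ /(_ y Xy) <- _] := lip.
  move=> [cu _]; apply: nXx; rewrite /state_set ltn_eqF //.
  by exists u.
have Cx : cluster ((fun k => xs k t) @ \oo) x by rewrite -KstarE.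
have [ub xub [u [G [FG ooG [xxb uub] uE]]]] :=
  cluster_trial_limit_control hP hx0 hsel hF hxs tT Xx Cx.
have Ky : Kstar t.+1 (dyn P t x ub).
  rewrite KstarE; apply: dyn_in_limsup ooG xxb uub _.
  by apply: filterS uE => k [].
have ubmin : argmin (fun v => bellman_u P t v (Vstar t.+1) x) ub.
  apply: (@argmin_limit _ _ _ _ _ _ _ hP G _ t (L t.+1)
    (fun k => sup_fun_set (F k t.+1)) _ (fun k => xs k t) u) => //.
  - by move=> y; apply: cvg_trans (hVstar t.+1 y tT) => A; exact: ooG.
  - apply: ooG; near=> k.
    apply: well_formed_lipschitz tT; first exact: wf.
    by near: k; exact: nbhs_infty_ge.
  - apply: nearW => k; apply: (trial_state_set hP hx0 hxs _ (ltnW tT)).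
    exact: wf.
  - by apply: filterS uE => k [].
rewrite (bellman_argmin ubmin).
have -> : bellman_u P t ub (Vstar t.+1) x =
    bellman_u P t ub (fun y => Vstar t.+1 y + edelta (Kstar t.+1) y)%dE x.
  by rewrite /bellman_u /edelta mem_set // dadde0.
by apply: ereal_inf_lbound; exists ub.
Unshelve. all: by end_near. Qed.
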